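(* Let $(\{(G^\sigma, d^\sigma)\}_{\sigma \in \Sigma}, \{\alpha^{\sigma}_{\tau} \colon G^\tau\to G^\sigma\}_{\sigma \leqslant \tau})$ be an inverse system, indexed by an upward directed set $\Sigma$, in the category of compact metric groups with non-expansive homomorphisms as arrows, and assume that $\alpha^\sigma_\tau$ is surjective for all $\sigma \leqslant \tau$. Assume that there exists a compact metric space $Z$ together with, for each $\sigma\in\Sigma$, a non-expansive surjection from $Z$ onto $G^\sigma$. Then this system has an inverse limit in this category. Furthermore, (1) the object of the inverse limit does not depend, up to isometric isomorphism, on the choice of surjective arrows for the system: if $(\{(G^\sigma, d^\sigma)\}_{\sigma \in \Sigma}, \{\beta^{\sigma}_{\tau}\}_{\sigma \leqslant \tau})$ is another inverse system in this category over the same $\Sigma$ with the same objects and with all arrows surjective, then the objects of the inverse limits of the two systems are isometrically isomorphic; (2) the arrows of the inverse limit are surjective.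
   Context: A metric group is a metrizable topological group $G$ together with a fixed left-invariant metric $d$ inducing its topology (no right-invariance is required). A mapping $f\colon (X,d)\to(Y,\varrho)$ is non-expansive if $\varrho(f(x),f(y))\leqslant d(x,y)$ for all $x,y\in X$. An inverse system in a category $\mathsf A$ indexed by an upward directed set $\Sigma$ is a family of objects $\{A^\sigma\}_{\sigma\in\Sigma}$ with morphisms $\{\alpha_\tau^\sigma\colon A^\tau\to A^\sigma\}_{\sigma\leqslant\tau}$ such that $\alpha_\sigma^\sigma=\mathrm{id}_{A^\sigma}$ and $\alpha_\varrho^\sigma\circ\alpha_\tau^\varrho=\alpha_\tau^\sigma$ for $\sigma\leqslant\varrho\leqslant\tau$. Its inverse limit is an object $A$ of $\mathsf A$ with morphisms $\{\alpha^\sigma\colon A\to A^\sigma\}_{\sigma\in\Sigma}$ such that $\alpha_\tau^\sigma\circ\alpha^\tau=\alpha^\sigma$ for $\sigma\leqslant\tau$, and such that for every object $A'$ and morphisms $\{\xi^\sigma\colon A'\to A^\sigma\}_{\sigma\in\Sigma}$ with $\alpha_\tau^\sigma\circ\xi^\tau=\xi^\sigma$ for $\sigma\leqslant\tau$ there is a unique morphism $\nu\colon A'\to A$ with $\alpha^\sigma\circ\nu=\xi^\sigma$ for all $\sigma\in\Sigma$. *)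

(* Defs.v *)
From HB Require Import structures.
From mathcomp Require Import all_boot all_order all_algebra.
From mathcomp Require Import boolp classical_sets functions reals topology.

Set Implicit Arguments.
Unset Strict Implicit.
Unset Printing Implicit Defensive.

Import Order.TTheory GRing.Theory Num.Theory.

Local Open Scope classical_set_scope.
Local Open Scope ring_scope.

(* The topology of a [metricType R] is the one induced by [mdist], so the
   continuity axioms say that [mdist] induces a group topology.  They do not
   follow from left-invariance alone, and right-invariance is not required. *)
HB.mixin Record isMetricGroup (R : realType) G & Metric R G & Group G := {
  mulg_continuous : continuous (fun z : G * G => (z.1 * z.2)%g) ;
  invg_continuous : continuous (fun x : G => (x^-1)%g) ;
  mdist_mulgl : forall a x y : G, mdist (a * x)%g (a * y)%g = mdist x y
}.

#[short(type="metricGroupType")]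
HB.structure Definition MetricGroup (R : realType) :=
  { G of Metric R G & Group G & isMetricGroup R G }.

HB.mixin Record isCompactMetricGroup (R : realType) G & MetricGroup R G := {
  compact_metric_group : compact [set: G]
}.

#[short(type="compactMetricGroupType")]
HB.structure Definition CompactMetricGroup (R : realType) :=
  { G of MetricGroup R G & isCompactMetricGroup R G }.

Section CompactMetricGroups.
Context {R : realType}.

Definition nonexpansive (X Y : metricType R) (f : X -> Y) : Prop :=
  forall x y, mdist (f x) (f y) <= mdist x y.

Definition surjective (X Y : Type) (f : X -> Y) : Prop :=
  set_surj [set: X] [set: Y] f.

(* Arrows of the category of compact metric groups.  A multiplicative map
   between groups automatically preserves units and inverses. *)
Definition cmg_arrow (G H : compactMetricGroupType R) (f : G -> H) : Prop :=
  {morph f : x y / (x * y)%g} /\ nonexpansive f.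

Definition isometrically_isomorphic (G H : compactMetricGroupType R) : Prop :=
  exists f : G -> H,
    [/\ bijective f,
        {morph f : x y / (x * y)%g} &
        forall x y, mdist (f x) (f y) = mdist x y].

Section InverseSystems.
Context {d : Order.disp_t} {Sigma : preorderType d}.

Definition upward_directed : Prop :=
  forall s t : Sigma, exists r : Sigma, (s <= r)%O /\ (t <= r)%O.

Context {G : Sigma -> compactMetricGroupType R}.

(* [alpha s t st : G t -> G s] is the bonding arrow for [st : s <= t]; it
   cannot depend on [st], since [s <= t] is a boolean equality. *)
Variable alpha : forall s t : Sigma, (s <= t)%O -> G t -> G s.

Record inverse_system : Prop := {
  inverse_system_arrow : forall (s t : Sigma) (st : (s <= t)%O),
    cmg_arrow (alpha st) ;
  inverse_system_id : forall (s : Sigma) (ss : (s <= s)%O), alpha ss = id ;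
  inverse_system_comp : forall (s r t : Sigma)
      (sr : (s <= r)%O) (rt : (r <= t)%O) (st : (s <= t)%O),
    alpha sr \o alpha rt = alpha st
}.

Record cone (A : compactMetricGroupType R) (pi : forall s, A -> G s) : Prop := {
  cone_arrow : forall s, cmg_arrow (pi s) ;
  cone_compat : forall (s t : Sigma) (st : (s <= t)%O),
    alpha st \o pi t = pi s
}.

Record inverse_limit (A : compactMetricGroupType R)
    (pi : forall s, A -> G s) : Prop := {
  inverse_limit_cone : cone pi ;
  inverse_limit_universal :
    forall (A' : compactMetricGroupType R) (xi : forall s, A' -> G s),
      cone xi ->
      exists! nu : A' -> A, cmg_arrow nu /\ forall s, pi s \o nu = xi s
}.

End InverseSystems.
End CompactMetricGroups.

Arguments upward_directed {d} Sigma.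

(* Main.v *)
Require Import Defs.
From HB Require Import structures.
From mathcomp Require Import all_boot all_order all_algebra.
From mathcomp Require Import boolp classical_sets functions reals topology.

Set Implicit Arguments.
Unset Strict Implicit.
Unset Printing Implicit Defensive.

(** The inverse limit is the group of threads of the system, with the distance
    [sup_s d_s (x_s, y_s)].  The bonding maps being non-expansive, these
    coordinate distances increase with [s].  Everything rests on limits along
    an ultrafilter [U] on the index set that contains every tail
    [{t | s <= t}] ([tail_ultrafilter]); such limits exist in compact spaces.

    Existence.  Coordinatewise everything is algebra; what has to be proved is
    that the threads are compact for the sup distance, whose topology could be
    finer than the product one.  The surjections [zeta_t : Z -> G_t] need not be
    compatible with the bonding maps, but
    [F_s z = lim_(t -> U) alpha_s^t (zeta_t z)] is, and the resulting map [F]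
    from [Z] to the threads is non-expansive.  Lifting points to [Z] along each
    [zeta_t] and taking limits along [U] in [Z] shows that [F] is onto the
    threads, and that each [F_s] is onto [G_s]
    ([thread_parametrization]).  So the threads are a non-expansive image of the
    compact space [Z], and the projections are onto.  Compactness then makes
    convergence of threads coordinatewise ([coordwise_cvg]), which gives
    continuity of the group operations without any right invariance.

    Independence of the bonding maps.  Of a limit [(A, pi)] one only retains
    that the [pi_s] are non-expansive epimorphisms whose pulled back distances
    increase with [s] and have the distance of [A] as supremum: [exhausting].
    Neither condition mentions the bonding maps.  Given two such families
    [pi_t : A -> G_t] and [rho_t : B -> G_t], choose arbitrary maps
    [k_t : A -> B] with [rho_t (k_t x) = pi_t x].  They are isometric
    homomorphisms up to the failure of [rho_t] to be isometric, a failure that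
    disappears in the limit, so [lim_(t -> U) k_t] is an isometric isomorphism
    ([exhausting_isometric_iso]).  Finally every inverse limit is exhausting,
    because it is isometric to the thread group over the system
    ([inverse_limit_exhausting]).

    A tail ultrafilter exists only on a nonempty index set; over an empty one,
    all the groups in play are trivial, which is treated apart. *)

Import Order.TTheory GRing.Theory Num.Theory.
Import metricType_numDomainType.

Local Open Scope classical_set_scope.
Local Open Scope ring_scope.

(** * Limits along ultrafilters *)

Lemma ultra_compact_cvg (I : Type) (U : set_system I) (Y : topologicalType)
    (f : I -> Y) :
  UltraFilter U -> compact [set: Y] -> exists y : Y, f @ U --> y.
Proof.
move=> UU cY.
have [y [_ fy]] := cY (f @ U) _ filterT.
exists y => V Vy.
have [//|UnV] := in_ultra_setVsetC (f @^-1` V) UU.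
by have [z [nVz Vz]] := fy (~` V) V UnV Vy.
Qed.

Lemma ultra_pointwise_cvg (I X : Type) (U : set_system I) (Y : topologicalType)
    (f : I -> X -> Y) :
  UltraFilter U -> compact [set: Y] ->
  exists g : X -> Y, forall x, f ^~ x @ U --> g x.
Proof.
move=> UU cY.
have /choice[g fg] x : exists y : Y, f ^~ x @ U --> y by exact: ultra_compact_cvg.
by exists g.
Qed.

Lemma tail_ultrafilter (d : Order.disp_t) (Sigma : preorderType d) (s0 : Sigma) :
  upward_directed Sigma ->
  exists U : set_system Sigma,
    UltraFilter U /\ forall s, \forall t \near U, (s <= t)%O.
Proof.
move=> dir; pose tail (s : Sigma) := [set t : Sigma | (s <= t)%O].
have tailF : ProperFilter (filter_from setT tail).
  apply: filter_from_proper; last by move=> s _; exists s; exact: lexx.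
  apply: filter_from_filter; first by exists s0.
  move=> s t _ _; have [r [sr tr]] := dir s t; exists r => // u ru.
  by split; [exact: le_trans ru|exact: le_trans ru].
have [U [UU sU]] := ultraFilterLemma tailF.
by exists U; split=> // s; apply: sU; exists s.
Qed.

(** * Limits in metric spaces *)

Section MetricLimits.
Context {R : realType}.
Implicit Types X Y : metricType R.

Lemma nonexpansive_continuous X Y (f : X -> Y) :
  nonexpansive f -> continuous f.
Proof.
move=> nf x; apply/cvgrPdist_lt => e e0.
near=> y; apply: le_lt_trans (nf _ _) _.
by near: y; exact: (cvgr_dist_lt (@cvg_id _ (nbhs x))).
Unshelve. all: by end_near. Qed.

Lemma nonexpansive_cvg (I : Type) (F : set_system I) {FF : Filter F} X Y
    (h : X -> Y) (f : I -> X) (x : X) :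
  nonexpansive h -> f @ F --> x -> (fun i => h (f i)) @ F --> h x.
Proof.
by move=> nh; apply: continuous_cvg; exact: nonexpansive_continuous.
Qed.

Lemma metric_cvg_unique (I : Type) (F : set_system I) {FF : ProperFilter F} X
    (f : I -> X) (x y : X) : f @ F --> x -> f @ F --> y -> x = y.
Proof. by move=> fx fy; apply: (@cvg_unique _ (@metric_hausdorff _ X) (f @ F)). Qed.

Lemma dominated_cvg (I : Type) (F : set_system I) {FF : Filter F} X Y
    (f : I -> X) (x : X) (g : I -> Y) (y : Y) :
  f @ F --> x -> (\forall i \near F, mdist y (g i) <= mdist x (f i)) ->
  g @ F --> y.
Proof.
move=> fx gf; apply/cvgrPdist_lt => e e0.
near=> i; apply: (@le_lt_trans _ _ (mdist x (f i))); first by near: i.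
by near: i; exact: (cvgr_dist_lt fx).
Unshelve. all: by end_near. Qed.

Lemma le_mdist_cvg (I : Type) (F : set_system I) {FF : ProperFilter F} X
    (f g : I -> X) (x y : X) (c : R) :
  f @ F --> x -> g @ F --> y -> (\forall i \near F, mdist (f i) (g i) <= c) ->
  mdist x y <= c.
Proof.
move=> fx gy fg; apply/ler_addgt0Pl => e e0.
have e2 : 0 < e / 2 by rewrite divr_gt0.
near F => i.
have xi : mdist x (f i) <= e / 2 by near: i; apply: cvgr_dist_le fx _ e2.
have yi : mdist y (g i) <= e / 2 by near: i; apply: cvgr_dist_le gy _ e2.
have fgi : mdist (f i) (g i) <= c by near: i.
apply: le_trans (metric_triangle x (f i) y) _.
rewrite (splitr e) -addrA lerD//.
apply: le_trans (metric_triangle (f i) (g i) y) _.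
by rewrite addrC lerD// metric_sym.
Unshelve. all: by end_near. Qed.

(** Every point has a neighbourhood inside some ball around [x0] of integral
    radius; compactness makes one radius serve for all points. *)
Lemma compact_mdist_bounded X : compact [set: X] ->
  exists M : R, forall x y : X, mdist x y <= M.
Proof.
move=> /compact_near_coveringP cX.
have [[x0]|X0] := pselect (inhabited X); last first.
  by exists 0 => x; case: X0; exists.
have := cX nat \oo (fun n x => mdist x0 x <= n%:R) _ _.
case.
  move=> x _; exists (ball x 1, [set n : nat | mdist x0 x + 1 <= n%:R]) => /=.
    split; first exact: nbhsx_ballx.
    exists (Num.bound (mdist x0 x + 1)) => // n /= Mn.
    rewrite (le_trans (ltW (archi_boundP _)))//; first by rewrite addr_ge0// mdist_ge0.
    by rewrite ler_nat.
  move=> [y n] /= [xy]; apply: le_trans.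
  apply: le_trans (metric_triangle x0 x y) _; rewrite lerD2l.
  by move: xy; rewrite ballEmdist => /ltW.
move=> n _ /(_ n (leqnn n)) Mn; exists (n%:R + n%:R) => x y.
rewrite (le_trans (metric_triangle x x0 y))// lerD//; last exact: Mn.
by rewrite metric_sym; exact: Mn.
Qed.

Lemma nonexpansive_compact_surj X Y (f : X -> Y) :
  nonexpansive f -> surjective f -> compact [set: X] -> compact [set: Y].
Proof.
move=> nf sf cX.
have -> : [set: Y] = f @` [set: X] by apply/seteqP; split.
apply: continuous_compact => //; apply: continuous_subspaceT.
exact: nonexpansive_continuous.
Qed.

(** No Hausdorff topology is strictly coarser than a compact one, so the topology
    of [X] is the one pulled back by the maps [p j].  Indeed the image under
    [p j] of a cluster point of [f @ F] is a cluster point of a filter that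
    converges to [p j x], so [x] is the only cluster point. *)
Lemma cvg_of_separating (I : Type) (F : set_system I) {FF : ProperFilter F} X
    (J : Type) (Y : J -> metricType R) (p : forall j, X -> Y j) (f : I -> X) (x : X) :
  compact [set: X] -> (forall j, continuous (p j)) ->
  (forall y, (forall j, p j y = p j x) -> y = x) ->
  (forall j, (p j \o f) @ F --> p j x) -> f @ F --> x.
Proof.
move=> cX pc psep pf.
apply: (@compact_cluster_set1 _ x (f @ F) setT) => //.
- exact: metric_hausdorff.
- exact: filterT.
- exact: filterT.
have sub : cluster (f @ F) `<=` [set x].
  move=> y fy; apply: psep => j; apply: (@metric_hausdorff _ (Y j)) => V W Vy Wx.
  have [z [Wz Vz]] := fy (p j @^-1` W) (p j @^-1` V) (pf j W Wx) (pc j y V Vy).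
  by exists (p j z).
apply/seteqP; split=> // _ ->.
have [y [_ fy]] := cX (f @ F) _ filterT.
by move: (sub _ fy) => <-.
Qed.

End MetricLimits.

(** * Groups exhausted by their projections *)

Section Exhausting.
Context {R : realType} {d : Order.disp_t} {Sigma : preorderType d}.
Context {G : Sigma -> compactMetricGroupType R}.

(** What is left of an inverse limit of epimorphisms once the bonding maps are
    forgotten.  The last two fields say that the distances pulled back from the
    [G s] increase to that of [A]; the bound [0 <= c] is there for an empty
    [Sigma], where the supremum is [0]. *)
Record exhausting (A : compactMetricGroupType R) (pi : forall s, A -> G s) :
    Prop := {
  exhausting_arrow : forall s, cmg_arrow (pi s) ;
  exhausting_surj : forall s, surjective (pi s) ;
  exhausting_mono : forall s t : Sigma, (s <= t)%O -> forall x y,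
    mdist (pi s x) (pi s y) <= mdist (pi t x) (pi t y) ;
  exhausting_sup : forall x y c, 0 <= c ->
    (forall s, mdist (pi s x) (pi s y) <= c) -> mdist x y <= c
}.

Section TwoGroups.
Variables (A B : compactMetricGroupType R).
Variables (pi : forall s, A -> G s) (rho : forall s, B -> G s).
Hypotheses (piE : exhausting pi) (rhoE : exhausting rho).

Lemma exhausting_inj (x y : A) : (forall s, pi s x = pi s y) -> x = y.
Proof.
move=> xy; apply/mdist_positivity/le_anti; rewrite mdist_ge0 andbT.
by apply: (exhausting_sup piE) => // s; rewrite xy mdistxx.
Qed.

(** The projections [rho s] separate points and detect distances, so an identity
    or an upper bound for the limit [h] of the [k t] can be checked after
    applying each [rho s].  There one may replace [s] by a later [t], at the cost
    of an inequality, and use that [rho t \o k t] is the non-expansive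
    homomorphism [pi t].  That [h] does not shrink distances is read off the
    [pi s] in the same way, [rho t] being non-expansive. *)
Lemma exhausting_isometric_iso (U : set_system Sigma) :
  UltraFilter U -> (forall s, \forall t \near U, (s <= t)%O) ->
  isometrically_isomorphic A B.
Proof.
move=> UU Utail.
have pin s : nonexpansive (pi s) by case: (exhausting_arrow piE s).
have piM s : {morph pi s : x y / (x * y)%g} by case: (exhausting_arrow piE s).
have rhon s : nonexpansive (rho s) by case: (exhausting_arrow rhoE s).
have rhoM s : {morph rho s : x y / (x * y)%g}
  by case: (exhausting_arrow rhoE s).
(* The lifts are arbitrary: neither continuous nor multiplicative. *)
have lift_pi t x : exists y, rho t y = pi t x.
  by have [y _ <-] := exhausting_surj rhoE (I : setT (pi t x)); exists y.
have [k rhok] : {k : Sigma -> A -> B & forall t x, rho t (k t x) = pi t x}.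
  exists (fun t => projT1 (choice (lift_pi t))) => t x.
  by case: (choice (lift_pi t)).
have [h kh] := ultra_pointwise_cvg k UU (@compact_metric_group _ B).
have rhokh s x : (fun t => rho s (k t x)) @ U --> rho s (h x).
  exact: nonexpansive_cvg (rhon s) (kh x).
have hiso x y : mdist (h x) (h y) = mdist x y.
  apply/le_anti/andP; split.
    apply: (exhausting_sup rhoE) => [|s]; first exact: mdist_ge0.
    apply: (le_mdist_cvg (rhokh s x) (rhokh s y)).
    near=> t; apply: le_trans (exhausting_mono rhoE (_ : s <= t)%O _ _) _.
      by near: t; exact: Utail.
    by rewrite !rhok; exact: pin.
  apply: (exhausting_sup piE) => [|s]; first exact: mdist_ge0.
  apply/ler_addgt0Pl => e e0; have e2 : 0 < e / 2 by rewrite divr_gt0.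
  near U => t.
  have hx : mdist (k t x) (h x) <= e / 2.
    by rewrite metric_sym; near: t; exact: cvgr_dist_le (kh x) _ e2.
  have hy : mdist (h y) (k t y) <= e / 2.
    by near: t; exact: cvgr_dist_le (kh y) _ e2.
  apply: le_trans (exhausting_mono piE (_ : s <= t)%O _ _) _.
    by near: t; exact: Utail.
  rewrite -!rhok; apply: le_trans (rhon _ _ _) _.
  apply: le_trans (metric_triangle _ (h x) _) _.
  rewrite (splitr e) -addrA lerD// addrC.
  by apply: le_trans (metric_triangle _ (h y) _) _; rewrite lerD2l.
exists h; split=> //.
- have hinj : injective h.
    move=> x y hxy; apply: mdist_positivity.
    by rewrite -hiso hxy mdistxx.
  suff hsurj y : exists x, h x = y.
    have [g hg] := choice hsurj.
    by exists g => [x|//]; apply: hinj; rewrite hg.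
  (* The preimage of [y] is the limit of points that have, at stage [t], the
     same projection as [y]. *)
  have /choice[x_ pix_] t : exists x, pi t x = rho t y.
    by have [x _ <-] := exhausting_surj piE (I : setT (rho t y)); exists x.
  have [x xx] := ultra_compact_cvg x_ UU (@compact_metric_group _ A).
  exists x; apply/mdist_positivity/le_anti; rewrite mdist_ge0 andbT.
  apply: (exhausting_sup rhoE) => // s.
  suff -> : rho s (h x) = rho s y by rewrite mdistxx.
  apply: metric_cvg_unique (rhokh s x) _.
  apply: dominated_cvg xx _; near=> t; rewrite metric_sym.
  apply: le_trans (exhausting_mono rhoE (_ : s <= t)%O _ _) _.
    by near: t; exact: Utail.
  by rewrite rhok -pix_; exact: pin.
- move=> x y; apply/mdist_positivity/le_anti; rewrite mdist_ge0 andbT.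
  apply: (exhausting_sup rhoE) => // s.
  suff -> : rho s (h (x * y)%g) = rho s (h x * h y)%g by rewrite mdistxx.
  apply: metric_cvg_unique (rhokh s _) _.
  (* [k t (x * y)] and [k t x * k t y] have the same projection at stage [t],
     hence at every earlier stage. *)
  have kM : (fun t => rho s (k t x * k t y)%g) @ U --> rho s (h x * h y)%g.
    apply: (nonexpansive_cvg (rhon s)).
    exact: (cvg_comp2 (kh x) (kh y) (@mulg_continuous _ B (h x, h y))).
  apply: dominated_cvg kM _; near=> t.
  suff -> : rho s (k t (x * y)%g) = rho s (k t x * k t y)%g by [].
  apply/mdist_positivity/le_anti; rewrite mdist_ge0 andbT.
  apply: le_trans (exhausting_mono rhoE (_ : s <= t)%O _ _) _.
    by near: t; exact: Utail.
  by rewrite rhoM !rhok piM mdistxx.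
Unshelve. all: by end_near. Qed.

End TwoGroups.
End Exhausting.

(** * The group of threads of an inverse system *)

Section Threads.
Context {R : realType} {d : Order.disp_t} {Sigma : preorderType d}.
Context {G : Sigma -> compactMetricGroupType R}.
Variable alpha : forall s t : Sigma, (s <= t)%O -> G t -> G s.
Hypothesis alpha_sys : inverse_system alpha.

Let alphaM s t (st : (s <= t)%O) : {morph alpha st : x y / (x * y)%g}.
Proof. by case: (inverse_system_arrow alpha_sys st). Qed.

Let alpha_nonexp s t (st : (s <= t)%O) : nonexpansive (alpha st).
Proof. by case: (inverse_system_arrow alpha_sys st). Qed.

Let alpha1 s t (st : (s <= t)%O) : alpha st 1%g = 1%g.
Proof. by apply: (@mulgI _ (alpha st 1%g)); rewrite -alphaM !mulg1. Qed.

Let alphaV s t (st : (s <= t)%O) x : alpha st x^-1%g = (alpha st x)^-1%g.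
Proof. by apply: (@mulgI _ (alpha st x)); rewrite -alphaM !mulgV alpha1. Qed.

Record thread := Thread {
  coord :> forall s, G s ;
  coord_compat : forall s t (st : (s <= t)%O), alpha st (coord t) = coord s
}.

Implicit Types x y : thread.

Lemma thread_ext x y : (forall s, x s = y s) -> x = y.
Proof.
case: x y => [x xP] [y yP] /= xy; have {}xy : x = y by exact: functional_extensionality_dep.
by case: _ / xy yP => yP; congr Thread; exact: Prop_irrelevance.
Qed.

#[local] HB.instance Definition _ := gen_eqMixin thread.
#[local] HB.instance Definition _ := gen_choiceMixin thread.

Definition thread1 : thread := @Thread (fun=> 1%g) alpha1.

Fact threadV_compat x s t (st : (s <= t)%O) :
  alpha st (x t)^-1%g = (x s)^-1%g.
Proof. by rewrite alphaV coord_compat. Qed.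

Definition threadV x : thread := Thread (threadV_compat x).

Fact threadM_compat x y s t (st : (s <= t)%O) :
  alpha st (x t * y t)%g = (x s * y s)%g.
Proof. by rewrite alphaM !coord_compat. Qed.

Definition threadM (x y : thread) : thread := Thread (threadM_compat x y).

Fact threadMA : associative threadM.
Proof. by move=> x y z; apply: thread_ext => s /=; rewrite mulgA. Qed.
Fact thread1M : left_id thread1 threadM.
Proof. by move=> x; apply: thread_ext => s /=; rewrite mul1g. Qed.
Fact threadM1 : right_id thread1 threadM.
Proof. by move=> x; apply: thread_ext => s /=; rewrite mulg1. Qed.
Fact threadVM : left_inverse thread1 threadV threadM.
Proof. by move=> x; apply: thread_ext => s /=; rewrite mulVg. Qed.
Fact threadMV : right_inverse thread1 threadV threadM.
Proof. by move=> x; apply: thread_ext => s /=; rewrite mulgV. Qed.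

#[local] HB.instance Definition _ :=
  isGroup.Build thread threadMA thread1M threadM1 threadVM threadMV.

Variable M : R.
Hypothesis boundedM : forall s (x y : G s), mdist x y <= M.

(** The added [0] is the value of the supremum when [Sigma] is empty. *)
Definition thread_dist x y : R :=
  sup (0 |` range (fun s => mdist (x s) (y s))).

Lemma le_thread_dist x y s : mdist (x s) (y s) <= thread_dist x y.
Proof.
apply: ub_le_sup; last by right; exists s.
exists (Num.max 0 M) => _ [->|[t _ <-]]; rewrite le_max ?lexx//.
by rewrite boundedM orbT.
Qed.

Lemma thread_dist_le x y c : 0 <= c -> (forall s, mdist (x s) (y s) <= c) ->
  thread_dist x y <= c.
Proof.
move=> c0 xyc; apply: ge_sup; first by exists 0; left.
by move=> _ [->//|[t _ <-]].
Qed.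

Fact thread_dist_ge0 x y : 0 <= thread_dist x y.
Proof.
apply: ub_le_sup; last by left.
exists (Num.max 0 M) => _ [->|[t _ <-]]; rewrite le_max ?lexx//.
by rewrite boundedM orbT.
Qed.

Fact thread_distxx x : thread_dist x x = 0.
Proof.
apply/le_anti; rewrite thread_dist_ge0 andbT thread_dist_le// => s.
by rewrite mdistxx.
Qed.

Fact thread_dist_pos x y : thread_dist x y = 0 -> x = y.
Proof.
move=> xy; apply: thread_ext => s; apply/mdist_positivity/le_anti.
by rewrite mdist_ge0 -xy le_thread_dist.
Qed.

Fact thread_dist_sym x y : thread_dist x y = thread_dist y x.
Proof.
by apply/le_anti/andP; split; apply: thread_dist_le (thread_dist_ge0 _ _) _ => s;
  rewrite metric_sym le_thread_dist.
Qed.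

Fact thread_dist_triangle y x z :
  thread_dist x z <= thread_dist x y + thread_dist y z.
Proof.
apply: thread_dist_le => [|s]; first by rewrite addr_ge0// thread_dist_ge0.
by rewrite (le_trans (metric_triangle _ (y s) _))// lerD// le_thread_dist.
Qed.

#[local] HB.instance Definition _ := isMetric.Build R thread
  thread_distxx thread_dist_pos thread_dist_sym thread_dist_triangle.

Lemma coord_nonexpansive s : nonexpansive (coord ^~ s : thread -> G s).
Proof. by move=> x y; exact: le_thread_dist. Qed.

(** The bonding map extended to all pairs of indices, so that limits can be
    taken over the whole of [Sigma]; the junk value is forgotten along any
    filter containing the tails. *)
Definition push s t (u : G t) : G s :=
  match @idP (s <= t)%O with
  | ReflectT st => alpha st u
  | ReflectF _ => 1%g
  end.

Lemma pushE s t (st : (s <= t)%O) u : push s u = alpha st u.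
Proof.
rewrite /push; case: {-}_ / idP => [st'|/(_ st)//].
by rewrite (bool_irrelevance st st').
Qed.

Hypothesis alpha_surj : forall s t (st : (s <= t)%O), surjective (alpha st).
Hypothesis Sigma_directed : upward_directed Sigma.
Variable Z : metricType R.
Hypothesis Z_compact : compact [set: Z].
Variable zeta : forall s, Z -> G s.
Hypothesis zeta_nonexp : forall s, nonexpansive (zeta s).
Hypothesis zeta_surj : forall s, surjective (zeta s).

(** The maps [zeta t], pushed down to the earlier stages, are compatible families
    over growing initial parts of [Sigma]; their limit is a family of maps
    compatible over all of [Sigma], that is a map into the threads.
    Surjectivity survives because preimages can be passed to the limit in
    [Z]. *)
Lemma thread_parametrization (s0 : Sigma) :
  exists F : Z -> thread, [/\ nonexpansive F, surjective F &
    forall s, surjective (fun z => F z s)].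
Proof.
have [U [UU Utail]] := tail_ultrafilter s0 Sigma_directed.
have /= lim_zeta s := ultra_pointwise_cvg (fun t z => push s (zeta t z)) UU
  (@compact_metric_group _ (G s)).
pose f s := projT1 (cid (lim_zeta s)).
have f_lim s z : (fun t => push s (zeta t z)) @ U --> f s z.
  by rewrite /f; case: cid.
have f_compat z s t (st : (s <= t)%O) : alpha st (f t z) = f s z.
  apply: (metric_cvg_unique _ (f_lim s z)).
  apply: (dominated_cvg (nonexpansive_cvg (alpha_nonexp st) (f_lim t z))).
  near=> r.
  have tr : (t <= r)%O by near: r; exact: Utail.
  rewrite (pushE tr) (pushE (le_trans st tr)).
  by rewrite -(inverse_system_comp alpha_sys st tr (le_trans st tr)).
pose F z := Thread (f_compat z).
have F_nonexp : nonexpansive F.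
  move=> z w; apply: thread_dist_le => [|s]; first exact: mdist_ge0.
  apply: (le_mdist_cvg (f_lim s z) (f_lim s w)); near=> t.
  have st : (s <= t)%O by near: t; exact: Utail.
  by rewrite !(pushE st) (le_trans (alpha_nonexp _ _ _))// zeta_nonexp.
have f_surj s : surjective (f s).
  (* A point of [G s] lifts to [z_ t] at each stage [t] past [s], and the limit
     of the [z_ t] is a preimage for the limit map. *)
  move=> u _; have lift_u t : exists z, (s <= t)%O -> push s (zeta t z) = u.
    have [st|nst] := boolP (s <= t)%O; last first.
      by have [z _ _] := zeta_surj (I : setT (1%g : G t)); exists z.
    have [v _ <-] := alpha_surj st (I : setT u).
    have [z _ <-] := zeta_surj (I : setT v).
    by exists z => _; rewrite pushE.
  have [z_ z_u] := choice lift_u.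
  have [z z_z] := ultra_compact_cvg z_ UU Z_compact.
  exists z => //; apply: metric_cvg_unique (f_lim s z) _.
  apply: dominated_cvg z_z _; near=> t.
  have st : (s <= t)%O by near: t; exact: Utail.
  rewrite -(z_u t st) !(pushE st) metric_sym.
  by rewrite (le_trans (alpha_nonexp _ _ _))// zeta_nonexp.
exists F; split=> //.
(* [w s] hits the thread [x] at stage [s], hence at every earlier one, so the
   limit of the [w s] hits it at all stages. *)
move=> x _; have /choice[w fw] s : exists w, f s w = x s.
  by have [w _ <-] := f_surj s _ (I : setT (x s)); exists w.
have [z wz] := ultra_compact_cvg w UU Z_compact.
exists z => //; apply: thread_ext => s /=.
have f_nonexp : nonexpansive (f s).
  move=> v v'; apply: le_trans (F_nonexp v v').
  exact: (le_thread_dist (F v) (F v')).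
apply: (metric_cvg_unique (nonexpansive_cvg f_nonexp wz)).
have xs : (fun _ : Sigma => x s) @ U --> x s by exact: cvg_cst.
apply: dominated_cvg xs _; near=> t.
have st : (s <= t)%O by near: t; exact: Utail.
by rewrite -(f_compat _ _ _ st) fw coord_compat.
Unshelve. all: by end_near. Qed.

Lemma thread_subsingleton : ~ inhabited Sigma -> forall x y, x = y.
Proof. by move=> S0 x y; apply: thread_ext => s; case: S0. Qed.

Lemma thread_compact : compact [set: thread].
Proof.
have [[s0]|S0] := pselect (inhabited Sigma).
  have [F [nF sF _]] := thread_parametrization s0.
  exact: nonexpansive_compact_surj nF sF Z_compact.
have -> : [set: thread] = [set thread1].
  by apply/seteqP; split=> // x _; exact: thread_subsingleton.
exact: compact_set1.
Qed.

Lemma coord_surj s : surjective (fun x : thread => x s).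
Proof.
have [F [_ _ Fs]] := thread_parametrization s.
by move=> u _; have [z _ <-] := Fs s u I; exists (F z).
Qed.

(** On threads the sup distance induces the topology of coordinatewise
    convergence.  This reduces continuity of the operations to that in each
    [G s]; it is not visible on the sup distance itself, as right translations
    of the [G s] have no common modulus of continuity a priori. *)
Lemma coordwise_cvg (I : Type) (F : set_system I) {FF : ProperFilter F}
    (f : I -> thread) x :
  (forall s, (fun i => f i s) @ F --> x s) -> f @ F --> x.
Proof.
move=> fx; apply: (cvg_of_separating (p := fun s (y : thread) => y s)) => //.
- exact: thread_compact.
- by move=> s; exact: nonexpansive_continuous (@coord_nonexpansive s).
- by move=> y; exact: thread_ext.
Qed.

Let coord_continuous s : continuous (fun x : thread => x s).
Proof. exact: nonexpansive_continuous (@coord_nonexpansive s). Qed.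

Fact threadM_continuous : continuous (fun p : thread * thread => (p.1 * p.2)%g).
Proof.
move=> [x y]; apply: coordwise_cvg => s.
have coord_cvg (p : thread * thread -> thread) (u : thread) :
    p @ (x, y) --> u -> (fun v => p v s) @ (x, y) --> u s.
  exact: (nonexpansive_cvg (h := fun v : thread => v s)
    (@coord_nonexpansive s)).
apply: (cvg_comp2 (coord_cvg fst x cvg_fst) (coord_cvg snd y cvg_snd)).
exact: (@mulg_continuous _ (G s) (x s, y s)).
Qed.

Fact threadV_continuous : continuous (fun x : thread => (x^-1)%g).
Proof.
move=> x; apply: (coordwise_cvg (F := nbhs x)) => s.
by apply: continuous_cvg (@invg_continuous _ (G s) (x s)) _; exact: coord_continuous.
Qed.

Fact thread_dist_mulgl (a x y : thread) :
  mdist (a * x)%g (a * y)%g = mdist x y.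
Proof.
by apply/le_anti/andP; split; apply: thread_dist_le (thread_dist_ge0 _ _) _ => s;
  [rewrite mdist_mulgl le_thread_dist
  |rewrite -(mdist_mulgl (a s)); exact: (le_thread_dist (a * x)%g (a * y)%g)].
Qed.

#[local] HB.instance Definition _ := isMetricGroup.Build R thread
  threadM_continuous threadV_continuous thread_dist_mulgl.
#[local] HB.instance Definition _ := isCompactMetricGroup.Build R thread thread_compact.

Definition thread_group : compactMetricGroupType R := thread.

Let proj s : thread_group -> G s := coord ^~ s.

Lemma proj_exhausting : exhausting proj.
Proof.
split=> [s|s|s t st x y|x y c]; last exact: thread_dist_le.
- by split; [|exact: coord_nonexpansive].
- exact: coord_surj.
- by rewrite /proj -(coord_compat x st) -(coord_compat y st) alpha_nonexp.
Qed.

Lemma proj_inverse_limit : inverse_limit alpha proj.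
Proof.
split.
  split=> [s|s t st]; first by split; [|exact: coord_nonexpansive].
  by apply/funext => x; exact: coord_compat.
move=> A' xi [xi_arrow xi_compat].
have nu_compat a s t (st : (s <= t)%O) : alpha st (xi t a) = xi s a.
  by rewrite -(xi_compat s t st).
exists (fun a => Thread (nu_compat a)); split.
  split=> [|s]; last exact/funext.
  split=> [a b|a b].
    by apply: thread_ext => s /=; case: (xi_arrow s) => ->.
  apply: thread_dist_le => [|s]; first exact: mdist_ge0.
  by case: (xi_arrow s) => _; exact.
move=> nu [_ nuE]; apply/funext => a; apply: thread_ext => s /=.
by rewrite -nuE.
Qed.

End Threads.

(** * Inverse limits of epimorphisms *)

Section InverseLimits.
Context {R : realType} {d : Order.disp_t} {Sigma : preorderType d}.
Context {G : Sigma -> compactMetricGroupType R}.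
Hypothesis Sigma_directed : upward_directed Sigma.
Variable Z : metricType R.
Hypothesis Z_compact : compact [set: Z].
Variable zeta : forall s, Z -> G s.
Hypothesis zeta_nonexp : forall s, nonexpansive (zeta s).
Hypothesis zeta_surj : forall s, surjective (zeta s).

Lemma exists_exhausting_limit
    (alpha : forall s t : Sigma, (s <= t)%O -> G t -> G s) :
  inverse_system alpha ->
  (forall s t (st : (s <= t)%O), surjective (alpha s t st)) ->
  exists (A : compactMetricGroupType R) (pi : forall s, A -> G s),
    inverse_limit alpha pi /\ exhausting pi.
Proof.
move=> sys surj; have [M ZM] := compact_mdist_bounded Z_compact.
have GM s (x y : G s) : mdist x y <= M.
  have [z _ <-] := zeta_surj (I : setT x).
  have [w _ <-] := zeta_surj (I : setT y).
  exact: le_trans (zeta_nonexp _ _ _) (ZM z w).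
exists (thread_group sys GM surj Sigma_directed Z_compact zeta_nonexp zeta_surj).
by eexists; split; [exact: proj_inverse_limit|exact: proj_exhausting].
Qed.

(** The comparison arrows [nu] and [mu] with the thread group are non-expansive
    and [mu \o nu] is the identity, so [nu] preserves distances and everything
    is inherited from the threads. *)
Lemma inverse_limit_exhausting
    (alpha : forall s t : Sigma, (s <= t)%O -> G t -> G s)
    (A : compactMetricGroupType R) (pi : forall s, A -> G s) :
  inverse_system alpha ->
  (forall s t (st : (s <= t)%O), surjective (alpha s t st)) ->
  inverse_limit alpha pi -> exhausting pi.
Proof.
move=> sys surj [piC piU].
have [A0 [pi0 [[pi0C pi0U] pi0E]]] := exists_exhausting_limit sys surj.
have [nu [[[nuM nu_nonexp] nuE] _]] := pi0U _ _ piC.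
have [mu [[[muM mu_nonexp] muE] _]] := piU _ _ pi0C.
have nuK : cancel nu mu.
  have [i [_ i_uniq]] := piU _ _ piC.
  suff e : mu \o nu = id by move=> x; rewrite -[LHS]/((mu \o nu) x) e.
  rewrite -(i_uniq (mu \o nu)); last first.
    split=> [|s]; last by rewrite -[RHS]nuE -muE.
    split=> [x y|x y]; first by rewrite /= nuM muM.
    exact: le_trans (mu_nonexp _ _) (nu_nonexp _ _).
  by apply: i_uniq; split=> //; split=> // x y; exact: lexx.
split=> [s|s u _|s t st x y|x y c c0 xyc].
- exact: cone_arrow piC s.
- have [x _ <-] := exhausting_surj pi0E (I : setT u).
  by exists (mu x) => //; rewrite -muE.
- by rewrite -!nuE /=; exact: exhausting_mono pi0E _ _ st _ _.
- rewrite -(nuK x) -(nuK y); apply: le_trans (mu_nonexp _ _) _.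
  apply: (exhausting_sup pi0E) => // s.
  by rewrite -![pi0 s _]/((pi0 s \o nu) _) nuE.
Qed.

End InverseLimits.

Lemma exhausting_isometrically_isomorphic (R : realType) (d : Order.disp_t)
    (Sigma : preorderType d) (G : Sigma -> compactMetricGroupType R)
    (A B : compactMetricGroupType R)
    (pi : forall s, A -> G s) (rho : forall s, B -> G s) :
  upward_directed Sigma -> exhausting pi -> exhausting rho ->
  isometrically_isomorphic A B.
Proof.
move=> dir piE rhoE; have [[s0]|S0] := pselect (inhabited Sigma).
  have [U [UU Utail]] := tail_ultrafilter s0 dir.
  exact: (exhausting_isometric_iso piE rhoE UU Utail).
have A1 (x : A) : x = 1%g.
  by apply: (exhausting_inj piE) => s; case: S0.
have B1 (x : B) : x = 1%g.
  by apply: (exhausting_inj rhoE) => s; case: S0.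
exists (fun=> 1%g); split=> [|x y|x y].
- by exists (fun=> 1%g) => x; rewrite ?(A1 x) ?(B1 x).
- by rewrite mulg1.
- by rewrite (A1 x) (A1 y) !mdistxx.
Qed.

Theorem theorem4p3 (R : realType)
    (d : Order.disp_t) (Sigma : preorderType d)
    (Sigma_directed : upward_directed Sigma)
    (G : Sigma -> compactMetricGroupType R)
    (alpha : forall s t : Sigma, (s <= t)%O -> G t -> G s)
    (alpha_sys : inverse_system alpha)
    (alpha_surj : forall (s t : Sigma) (st : (s <= t)%O), surjective (alpha s t st))
    (Z : metricType R) (Z_compact : compact [set: Z])
    (zeta : forall s : Sigma, Z -> G s)
    (zeta_nonexp : forall s, nonexpansive (zeta s))
    (zeta_surj : forall s, surjective (zeta s)) :
  (exists (A : compactMetricGroupType R) (pi : forall s, A -> G s),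
     inverse_limit alpha pi)
  /\
  (forall beta : forall s t : Sigma, (s <= t)%O -> G t -> G s,
     inverse_system beta ->
     (forall (s t : Sigma) (st : (s <= t)%O), surjective (beta s t st)) ->
     forall (A B : compactMetricGroupType R)
            (pi : forall s, A -> G s) (rho : forall s, B -> G s),
       inverse_limit alpha pi -> inverse_limit beta rho ->
       isometrically_isomorphic A B)
  /\
  (forall (A : compactMetricGroupType R) (pi : forall s, A -> G s),
     inverse_limit alpha pi -> forall s, surjective (pi s)).
Proof.
have [A0 [pi0 [pi0L _]]] := exists_exhausting_limit Sigma_directed Z_compact
  zeta_nonexp zeta_surj alpha_sys alpha_surj.
have limitE := inverse_limit_exhausting Sigma_directed Z_compact
  zeta_nonexp zeta_surj.
split; first by exists A0, pi0.
split=> [beta beta_sys beta_surj A B pi rho piL rhoL|A pi piL s].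
  apply: (exhausting_isometrically_isomorphic Sigma_directed).
    exact: limitE alpha_sys alpha_surj piL.
  exact: limitE beta_sys beta_surj rhoL.
exact: exhausting_surj (limitE _ _ _ alpha_sys alpha_surj piL) s.
Qed.
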